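(* Let $K$ be a knot in $S^3$ with knot group $G_K$, let $k$ be a perfect field with $\mathrm{char}(k)\neq 2$, let $\mathcal{O}$ be a complete discrete valuation ring with residue field $k$, and let $\overline{\rho}: G_K \to \mathrm{SL}_2(k)$ be an absolutely irreducible representation with universal deformation $\boldsymbol{\rho}: G_K \to \mathrm{SL}_2(\boldsymbol{R}_{\overline{\rho}})$. Suppose that the following two conditions are satisfied: (1) $\boldsymbol{R}_{\overline{\rho}}$ is a Noetherian integral domain. (2) There are a deformation $\rho: G_K \to \mathrm{SL}_2(R)$ of $\overline{\rho}$, where $R$ is an object of $\mathfrak{CL}_{\mathcal{O}}$ which is a Noetherian factorial domain, and an element $g \in G_K$ such that (2-1) $\det(\rho(g)-I)\neq 0$ and (2-2) $\Delta_K(\rho;1)\neq 0$. Then the twisted knot module $H_1(\boldsymbol{\rho})$ is a finitely generated torsion $\boldsymbol{R}_{\overline{\rho}}$-module.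
   Context: Deformations. $\mathfrak{CL}_{\mathcal{O}}$ is the category of complete local $\mathcal{O}$-algebras with residue field $k$, with morphisms the $\mathcal{O}$-algebra homomorphisms inducing the identity on residue fields; $\mathfrak{m}_R$ is the maximal ideal of $R$. A deformation of $\overline{\rho}$ over $R\in\mathfrak{CL}_{\mathcal{O}}$ is a representation $\rho: G_K\to \mathrm{SL}_2(R)$ with $\rho \bmod \mathfrak{m}_R=\overline{\rho}$. Two representations $\rho_1,\rho_2$ of degree 2 over a local ring $A$ are strictly equivalent, $\rho_1\approx\rho_2$, if there is $\gamma\in I_2+\mathrm{M}_2(\mathfrak{m}_A)$ with $\rho_2(g)=\gamma^{-1}\rho_1(g)\gamma$ for all $g$. The universal deformation $(\boldsymbol{R}_{\overline{\rho}},\boldsymbol{\rho})$ is a deformation of $\overline{\rho}$ such that for any deformation $(R,\rho)$ there is a unique morphism $\psi:\boldsymbol{R}_{\overline{\rho}}\to R$ in $\mathfrak{CL}_{\mathcal{O}}$ with $\psi\circ\boldsymbol{\rho}\approx\rho$ (it is known to exist for absolutely irreducible $\overline{\rho}$ and $\mathrm{char}(k)\ne 2$). Absolutely irreducible means irreducible over an algebraic closure of $k$. Twisted knot module. $E_K:=S^3\setminus K$, $G_K:=\pi_1(E_K)$, with a deficiency-one presentation $G_K=\langle g_1,\dots,g_n\mid r_1=\cdots=r_{n-1}=1\rangle$ (for example the Wirtinger presentation). Let $F$ be the free group on $g_1,\dots,g_n$ and $\pi:\mathbb{Z}[F]\to\mathbb{Z}[G_K]$ the natural map. Let $V_{\boldsymbol{\rho}}=(\boldsymbol{R}_{\overline{\rho}})^{\oplus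 2}$ (column vectors) with $G_K$ acting via $\boldsymbol{\rho}$. Then $H_i(\boldsymbol{\rho}):=H_i(E_K;V_{\boldsymbol{\rho}})$ is the homology of the complex $0\to (V_{\boldsymbol{\rho}})^{\oplus(n-1)}\xrightarrow{\partial_2}(V_{\boldsymbol{\rho}})^{\oplus n}\xrightarrow{\partial_1}V_{\boldsymbol{\rho}}\to 0$, with $\partial_1=(\boldsymbol{\rho}(g_1)-I,\dots,\boldsymbol{\rho}(g_n)-I)$ and $\partial_2=\big(\boldsymbol{\rho}\circ\pi(\partial r_j/\partial g_i)\big)_{i,j}$, where $\partial/\partial g_i:\mathbb{Z}[F]\to\mathbb{Z}[F]$ is the Fox derivative and $\boldsymbol{\rho}$ is extended linearly to $\mathbb{Z}[G_K]\to \mathrm{M}_2(\boldsymbol{R}_{\overline{\rho}})$. It is the homology of the presentation CW complex (one 0-cell, $n$ 1-cells, $n-1$ 2-cells), which is homotopy equivalent to $E_K$. Twisted Alexander invariant. Let $A$ be a Noetherian factorial domain with fraction field $Q(A)$, $\rho:G_K\to\mathrm{SL}_2(A)$ a representation, and $\alpha:G_K\to\langle t\rangle\simeq\mathbb{Z}$ the abelianization map. Let $\Phi:A[F]\to\mathrm{M}_2(A[t^{\pm1}])$ be the $A$-algebra homomorphism induced by $F\to G_K$ and $\rho\otimes\alpha$. Let $P$ be the (big) $n\times(n-1)$ matrix with $(i,j)$ entry the $2\times 2$ matrix $\Phi(\partial r_j/\partial g_i)$, let $P_i$ be obtained from $P$ by deleting the $i$-th (block) row, regarded as a $2(n-1)\times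 2(n-1)$ matrix over $A[t^{\pm1}]$, and let $D_i$ be the greatest common divisor of its $2(n-1)$-minors. There is an $i$ with $\det\Phi(g_i-1)\neq0$, and $\Delta_K(\rho;t):=D_i/\det\Phi(g_i-1)\in Q(A)(t)$ is independent of such $i$ (up to units of $A[t^{\pm1}]$). $\Delta_K(\rho;1)$ denotes its value at $t=1$. *)

(* Defs.v *)
From HB Require Import structures.
From mathcomp Require Import all_boot all_order all_algebra.
From mathcomp Require Import generic_quotient ring_quotient fraction separable.
From mathcomp Require Import ring lra.
From mathcomp Require Import all_classical all_reals all_analysis.
From mathcomp Require Import homotopy.
Import Order.TTheory GRing.Theory Num.Theory.
Import numFieldNormedType.Exports.

Set Implicit Arguments.
Unset Strict Implicit.
Unset Printing Implicit Defensive.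

Local Open Scope classical_set_scope.
Local Open Scope ring_scope.
Local Open Scope quotient_scope.

Definition unit_interval (R : realType) : Type := set_type [set x : R | 0 <= x <= 1].

HB.instance Definition _ (R : realType) := Topological.on (unit_interval R).

Section UnitInterval.
Variable R : realType.
Implicit Types x y : R.

Definition clampr x : R := Num.max 0 (Num.min 1 x).

Lemma clampr_itv x : clampr x \in [set x : R | 0 <= x <= 1].
Proof.
rewrite inE /= /clampr le_max lexx /= ge_max ler01 /=.
by rewrite ge_min lexx.
Qed.

Definition clamp x : unit_interval R := SigSub (clampr_itv x).

Lemma clampr_id x : 0 <= x <= 1 -> clampr x = x.
Proof.
by case/andP=> x0 x1; rewrite /clampr (min_idPr x1) (max_idPr x0).
Qed.

Lemma clampr0 x : x <= 0 -> clampr x = 0.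
Proof.
by move=> x0; rewrite /clampr (min_idPr (le_trans x0 ler01)) (max_idPl x0).
Qed.

Lemma clampr1 x : 1 <= x -> clampr x = 1.
Proof. by move=> x1; rewrite /clampr (min_idPl x1) (max_idPr ler01). Qed.

Lemma val01 (t : unit_interval R) : 0 <= val t <= 1.
Proof. by case: t => x /=; rewrite inE. Qed.

Lemma val_clamp x : val (clamp x) = clampr x. Proof. by []. Qed.

Lemma clampK (t : unit_interval R) : clamp (val t) = t.
Proof. by apply: val_inj; rewrite val_clamp clampr_id// val01. Qed.

Lemma clamp01_neq : clamp 0 != clamp 1.
Proof.
apply/eqP => /(congr1 val); rewrite !val_clamp clampr0// clampr1//.
by move/eqP; rewrite eq_sym oner_eq0.
Qed.

HB.instance Definition _ := isBiPointed.Build (unit_interval R) clamp01_neq.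

Lemma clamp0E x : x <= 0 -> clamp x = zero.
Proof. by move=> x0; apply: val_inj; rewrite /= !clampr0. Qed.

Lemma clamp1E x : 1 <= x -> clamp x = one.
Proof. by move=> x1; apply: val_inj; rewrite /= !clampr1. Qed.

Lemma val0E : val (zero : unit_interval R) = 0. Proof. exact: clampr0. Qed.
Lemma val1E : val (one : unit_interval R) = 1. Proof. exact: clampr1. Qed.

Lemma clampr00 : clampr 0 = 0. Proof. exact: clampr0. Qed.
Lemma clampr11 : clampr 1 = 1. Proof. exact: clampr1. Qed.
Definition v01E := (val0E, val1E, clampr00, clampr11).

Lemma val_continuous : continuous (fun t : unit_interval R => val t).
Proof. exact: initial_continuous. Qed.

Lemma clamp_continuous : continuous clamp.
Proof.
apply: (@continuous_comp_initial _ _ _ set_val) => x.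
rewrite [_ \o _](_ : _ = (cst 0 \max (cst 1 \min id))); last exact/funext.
apply: (@continuous_max R R); first exact: cvg_cst.
by apply: (@continuous_min R R); [exact: cvg_cst|exact: cvg_id].
Qed.

End UnitInterval.

Lemma paste (R : realType) (T X : topologicalType) (c : T -> R) (F G : T -> X) :
  continuous c -> continuous F -> continuous G ->
  (forall t, c t = 2^-1 -> F t = G t) ->
  continuous (fun t => if c t <= 2^-1 then F t else G t).
Proof.
move=> cc cF cG FG.
set H := fun t => _.
have cA : closed [set t | c t <= 2^-1].
  by have /continuous_closedP/(_ _ (@closed_le R 2^-1)) := cc.
have cB : closed [set t | 2^-1 <= c t].
  by have /continuous_closedP/(_ _ (@closed_ge R 2^-1)) := cc.
have UT : [set t | c t <= 2^-1] `|` [set t | 2^-1 <= c t] = setT.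
  by apply/seteqP; split=> t //= _; case: (leP (c t) 2^-1) => [|/ltW]; [left|right].
apply/continuous_subspace_setT; rewrite -UT.
apply: withinU_continuous => //.
  apply: (@subspace_eq_continuous _ _ _ F); last exact: continuous_subspaceT.
  by move=> t /set_mem /= ct; rewrite /from_subspace /H ct.
apply: (@subspace_eq_continuous _ _ _ G); last exact: continuous_subspaceT.
move=> t /set_mem /= ct; rewrite /from_subspace /H; case: ifP => // ct'.
by rewrite FG//; apply/eqP; rewrite eq_le ct ct'.
Qed.

Section Loops.
Variables (R : realType) (X : topologicalType) (x0 : X).
Local Notation I := (unit_interval R).
Local Notation loop := {path I from x0 to x0 in X}.
Implicit Types f g h : loop.

(* Homotopy relative to the endpoints; the first coordinate is the deformation
   parameter. *)
Definition path_homotopic (f g : I -> X) : Prop :=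
  exists H : I * I -> X,
    [/\ continuous H, forall t, H (zero, t) = f t, forall t, H (one, t) = g t,
        forall s, H (s, zero) = x0 & forall s, H (s, one) = x0].

Lemma cont_clamp (T : topologicalType) (phi : T -> R) :
  continuous phi -> continuous (fun t => clamp (phi t)).
Proof.
by move=> cp x; apply: (@continuous_comp _ _ _ phi (@clamp R));
  [exact: cp|exact: clamp_continuous].
Qed.

Lemma cont_comp (S T U : topologicalType) (f : S -> T) (g : T -> U) :
  continuous f -> continuous g -> continuous (fun x => g (f x)).
Proof. by move=> cf cg x; apply: (continuous_comp (cf _) (cg _)). Qed.

Lemma cont_pair (S T U : topologicalType) (f : S -> T) (g : S -> U) :
  continuous f -> continuous g -> continuous (fun x => (f x, g x)).
Proof. by move=> cf cg x; apply: cvg_pair; [exact: cf|exact: cg]. Qed.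

Lemma cont_fst (S T : topologicalType) : continuous (@fst S T).
Proof. by move=> x; exact: cvg_fst. Qed.

Lemma cont_snd (S T : topologicalType) : continuous (@snd S T).
Proof. by move=> x; exact: cvg_snd. Qed.

Lemma cont_cst (S T : topologicalType) (a : T) : continuous (fun _ : S => a).
Proof. by move=> x; exact: cvg_cst. Qed.

Lemma cont_add (T : topologicalType) (f g : T -> R) :
  continuous f -> continuous g -> continuous (fun x => f x + g x).
Proof. by move=> cf cg x; apply: continuousD; [exact: cf|exact: cg]. Qed.

Lemma cont_opp (T : topologicalType) (f : T -> R) :
  continuous f -> continuous (fun x => - f x).
Proof. by move=> cf x; apply: continuousN; exact: cf. Qed.

Lemma cont_mul (T : topologicalType) (f g : T -> R) :
  continuous f -> continuous g -> continuous (fun x => f x * g x).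
Proof. by move=> cf cg x; apply: continuousM; [exact: cf|exact: cg]. Qed.

Lemma cont_min (T : topologicalType) (f g : T -> R) :
  continuous f -> continuous g -> continuous (fun x => Num.min (f x) (g x)).
Proof.
by move=> cf cg x; apply: (@continuous_min R _ f g); [exact: cf|exact: cg].
Qed.

Lemma cont_max (T : topologicalType) (f g : T -> R) :
  continuous f -> continuous g -> continuous (fun x => Num.max (f x) (g x)).
Proof.
by move=> cf cg x; apply: (@continuous_max R _ f g); [exact: cf|exact: cg].
Qed.

Lemma cont_val : continuous (fun t : I => val t).
Proof. exact: val_continuous. Qed.

Lemma cont_id (T : topologicalType) : continuous (fun x : T => x).
Proof. by move=> x; exact: cvg_id. Qed.

Ltac cts := repeat first
  [ exact: cont_cst | exact: cont_id | exact: cont_fst | exact: cont_snd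
  | exact: cont_val | exact: cts_fun
  | apply: cont_add | apply: cont_opp | apply: cont_mul
  | apply: cont_min | apply: cont_max | apply: cont_clamp
  | apply: (cont_comp (@cont_fst _ _)) | apply: (cont_comp (@cont_snd _ _))
  | apply: (cont_comp cont_val) ].

Lemma homotopic_refl f : path_homotopic f f.
Proof.
exists (fun st => f st.2); split=> //=.
- exact: (cont_comp (@cont_snd _ _) cts_fun).
- by move=> s; rewrite path_zero.
- by move=> s; rewrite path_one.
Qed.

Lemma homotopic_sym (f g : I -> X) : path_homotopic f g -> path_homotopic g f.
Proof.
move=> [H [cH H0 H1 Hz Ho]].
exists (fun st => H (clamp (1 - val st.1), st.2)); split=> //=.
- apply: (@cont_comp _ _ _ (fun st : I * I => (clamp (1 - val st.1), st.2)) H) => //.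
  apply: cont_pair; last exact: cont_snd.
  by apply: cont_clamp; apply: cont_add; cts.
- by move=> t; rewrite ?v01E subr0 clamp1E.
- by move=> t; rewrite ?v01E subrr clamp0E.
Qed.

Lemma homotopic_trans (f g h : I -> X) :
  path_homotopic f g -> path_homotopic g h -> path_homotopic f h.
Proof.
move=> [H [cH H0 H1 Hz Ho]] [K [cK K0 K1 Kz Ko]].
exists (fun st => if val st.1 <= 2^-1 then H (clamp (2 * val st.1), st.2)
                  else K (clamp (2 * val st.1 - 1), st.2)); split=> /=.
- apply: (@paste R _ _ (fun st : I * I => val st.1)
    (fun st => H (clamp (2 * val st.1), st.2))
    (fun st => K (clamp (2 * val st.1 - 1), st.2))).
  + exact: (cont_comp (@cont_fst _ _) cont_val).
  + apply: (@cont_comp _ _ _ (fun st : I * I => (clamp (2 * val st.1), st.2)) H) => //.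
    by apply: cont_pair; [apply: cont_clamp; apply: cont_mul; cts | exact: cont_snd].
  + apply: (@cont_comp _ _ _
      (fun st : I * I => (clamp (2 * val st.1 - 1), st.2)) K) => //.
    by apply: cont_pair; [apply: cont_clamp; apply: cont_add; cts| exact: cont_snd].
  + move=> [s t] /= ->; rewrite mulfV ?pnatr_eq0// subrr clamp1E// clamp0E//.
    by rewrite H1 K0.
- by move=> t; rewrite ?v01E mulr0 invr_ge0 ler0n clamp0E.
- move=> t; rewrite ?v01E mulr1 ifN ?clamp1E//; first by lra.
  by rewrite -ltNge; lra.
- by move=> s; case: ifP.
- by move=> s; case: ifP.
Qed.

Lemma homotopic_eq (f g f' g' : I -> X) :
  path_homotopic f g -> f =1 f' -> g =1 g' -> path_homotopic f' g'.
Proof. by move=> ? /funext <- /funext <-. Qed.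

Lemma homotopic_reparam f (phi psi : R -> R) :
  continuous phi -> continuous psi ->
  clamp (phi 0) = clamp (psi 0) -> clamp (phi 1) = clamp (psi 1) ->
  f (clamp (phi 0)) = x0 -> f (clamp (phi 1)) = x0 ->
  path_homotopic (fun t => f (clamp (phi (val t))))
                 (fun t => f (clamp (psi (val t)))).
Proof.
move=> cphi cpsi e0 e1 f0 f1.
exists (fun st => f (clamp ((1 - val st.1) * val (clamp (phi (val st.2)))
                     + val st.1 * val (clamp (psi (val st.2)))))); split=> /=.
- apply: (@cont_comp _ _ _ (fun st : I * I =>
    (clamp ((1 - val st.1) * val (clamp (phi (val st.2)))
                     + val st.1 * val (clamp (psi (val st.2)))))) f);
    last exact: cts_fun.
  have cl (chi : R -> R) : continuous chi ->
      continuous (fun st : I * I => val (clamp (chi (val st.2)))).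
    move=> cchi.
    apply: (@cont_comp _ _ _ (fun st : I * I => clamp (chi (val st.2))));
      last exact: cont_val.
    apply: cont_clamp; apply: (@cont_comp _ _ _ (fun st : I * I => val st.2) chi) => //.
    exact: (cont_comp (@cont_snd _ _) cont_val).
  have c1 : continuous (fun st : I * I => val st.1).
    exact: (cont_comp (@cont_fst _ _) cont_val).
  apply: cont_clamp; apply: cont_add; apply: cont_mul => //; try exact: cl.
  by apply: cont_add; [exact: cont_cst|exact: cont_opp].
- by move=> t; rewrite ?v01E subr0 mul1r mul0r addr0 (clampK (clamp (phi (val t)))).
- by move=> t; rewrite ?v01E subrr mul1r mul0r add0r (clampK (clamp (psi (val t)))).
- move=> s; rewrite ?v01E [clampr (psi 0)](congr1 val (esym e0)) /=.
  by rewrite -mulrDl subrK mul1r -[RHS]f0; congr (f _); exact: (clampK (clamp _)).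
- move=> s; rewrite ?v01E [clampr (psi 1)](congr1 val (esym e1)) /=.
  by rewrite -mulrDl subrK mul1r -[RHS]f1; congr (f _); exact: (clampK (clamp _)).
Qed.

Definition concat_fun (f g : I -> X) (t : I) : X :=
  if val t <= 2^-1 then f (clamp (2 * val t)) else g (clamp (2 * val t - 1)).

Lemma concat_continuous f g : continuous (concat_fun f g).
Proof.
apply: (@paste R _ _ (fun t : I => val t) (fun t => f (clamp (2 * val t)))
   (fun t => g (clamp (2 * val t - 1)))).
- exact: cont_val.
- apply: (@cont_comp _ _ _ (fun t : I => clamp (2 * val t)) f); last exact: cts_fun.
  by apply: cont_clamp; apply: cont_mul; cts.
- apply: (@cont_comp _ _ _ (fun t : I => clamp (2 * val t - 1)) g); last exact: cts_fun.
  by apply: cont_clamp; apply: cont_add; cts.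
- move=> t ->; rewrite mulfV ?pnatr_eq0// subrr clamp1E// clamp0E//.
  by rewrite path_one path_zero.
Qed.

Lemma concat_zero f g : concat_fun f g zero = x0.
Proof. by rewrite /concat_fun val0E mulr0 invr_ge0 ler0n clamp0E// path_zero. Qed.

Lemma concat_one f g : concat_fun f g one = x0.
Proof.
rewrite /concat_fun val1E mulr1 ifN ?clamp1E ?path_one//; first by lra.
by rewrite -ltNge; lra.
Qed.

(* [f] is travelled first. *)
Definition loop_concat f g : loop :=
  mk_path (@concat_continuous f g) (concat_zero f g) (concat_one f g).

Definition rev_fun (f : I -> X) (t : I) : X := f (clamp (1 - val t)).

Lemma rev_continuous f : continuous (rev_fun f).
Proof.
apply: (@cont_comp _ _ _ (fun t : I => clamp (1 - val t)) f); last exact: cts_fun.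
by apply: cont_clamp; apply: cont_add; cts.
Qed.

Lemma rev_zero f : rev_fun f zero = x0.
Proof. by rewrite /rev_fun val0E subr0 clamp1E// path_one. Qed.

Lemma rev_one f : rev_fun f one = x0.
Proof. by rewrite /rev_fun val1E subrr clamp0E// path_zero. Qed.

Definition loop_rev f : loop :=
  mk_path (@rev_continuous f) (rev_zero f) (rev_one f).

Definition loop_cst : loop :=
  mk_path (@cont_cst I X x0) (erefl x0) (erefl x0).


Lemma concat_homotopic f f' g g' :
  path_homotopic f f' -> path_homotopic g g' ->
  path_homotopic (loop_concat f g) (loop_concat f' g').
Proof.
move=> [H [cH H0 H1 Hz Ho]] [K [cK K0 K1 Kz Ko]].
exists (fun st => if val st.2 <= 2^-1 then H (st.1, clamp (2 * val st.2))
                  else K (st.1, clamp (2 * val st.2 - 1))).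
have c2 : continuous (fun st : I * I => val st.2).
  exact: (cont_comp (@cont_snd _ _) cont_val).
split=> /=.
- apply: (@paste R _ _ (fun st : I * I => val st.2)
    (fun st => H (st.1, clamp (2 * val st.2)))
    (fun st => K (st.1, clamp (2 * val st.2 - 1)))) => //.
  + apply: (@cont_comp _ _ _ (fun st : I * I => (st.1, clamp (2 * val st.2))) H) => //.
    by apply: cont_pair; [exact: cont_fst | apply: cont_clamp; apply: cont_mul; cts].
  + apply: (@cont_comp _ _ _
      (fun st : I * I => (st.1, clamp (2 * val st.2 - 1))) K) => //.
    by apply: cont_pair; [exact: cont_fst | apply: cont_clamp; apply: cont_add; cts].
  + move=> [s t] /= ->; rewrite mulfV ?pnatr_eq0// subrr clamp1E// clamp0E//.
    by rewrite Ho Kz.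
- by move=> t; rewrite H0 K0.
- by move=> t; rewrite H1 K1.
- by move=> s; rewrite ?v01E mulr0 invr_ge0 ler0n clamp0E.
- move=> s; rewrite ?v01E mulr1 ifN ?clamp1E//; first by lra.
  by rewrite -ltNge; lra.
Qed.

Lemma rev_homotopic f f' :
  path_homotopic f f' -> path_homotopic (loop_rev f) (loop_rev f').
Proof.
move=> [H [cH H0 H1 Hz Ho]].
exists (fun st => H (st.1, clamp (1 - val st.2))); split=> /=.
- apply: (@cont_comp _ _ _ (fun st : I * I => (st.1, clamp (1 - val st.2))) H) => //.
  by apply: cont_pair; [exact: cont_fst | apply: cont_clamp; apply: cont_add; cts].
- by move=> t; rewrite H0.
- by move=> t; rewrite H1.
- by move=> s; rewrite ?v01E subr0 clamp1E.
- by move=> s; rewrite ?v01E subrr clamp0E.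
Qed.

Lemma homotopic_reparam_id f (phi : R -> R) : continuous phi ->
  clamp (phi 0) = zero -> clamp (phi 1) = one ->
  path_homotopic (fun t => f (clamp (phi (val t)))) f.
Proof.
move=> cphi p0 p1.
have h : path_homotopic (fun t => f (clamp (phi (val t))))
                        (fun t => f (clamp (id (val t)))).
  apply: (@homotopic_reparam f phi id) => //.
  - exact: cont_id.
  - by rewrite p0 path_zero.
  - by rewrite p1 path_one.
by apply: (homotopic_eq h) => // t; rewrite clampK.
Qed.

Lemma concat_cst_l f : path_homotopic (loop_concat loop_cst f) f.
Proof.
apply: (homotopic_eq (@homotopic_reparam_id f (fun x => 2 * x - 1) _ _ _)) => //.
- by apply: cont_add; cts.
- by rewrite clamp0E//; lra.
- by rewrite clamp1E//; lra.
- move=> t /=; rewrite /mk_path /concat_fun /=; case: ifP => // ht.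
  by rewrite clamp0E ?path_zero//; lra.
Qed.

Lemma concat_cst_r f : path_homotopic (loop_concat f loop_cst) f.
Proof.
apply: (homotopic_eq (@homotopic_reparam_id f (fun x => 2 * x) _ _ _)) => //.
- by apply: cont_mul; cts.
- by rewrite clamp0E//; lra.
- by rewrite clamp1E//; lra.
- move=> t /=; rewrite /mk_path /concat_fun /=; case: leP => // ht.
  by rewrite clamp1E ?path_one//; lra.
Qed.

Lemma concat_rev_r f : path_homotopic (loop_concat f (loop_rev f)) loop_cst.
Proof.
apply: (homotopic_eq (g := fun=> f (clamp 0))); first apply:
  (@homotopic_reparam f (fun x => Num.min (2 * x) (2 - 2 * x)) (fun=> 0)).
- by apply: cont_min; cts.
- exact: cont_cst.
- by rewrite mulr0 subr0 minEle ler0n.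
- by rewrite mulr1 subrr minEge ler0n.
- by rewrite mulr0 subr0 minEle ler0n clamp0E// path_zero.
- by rewrite mulr1 subrr minEge ler0n clamp0E// path_zero.
- move=> t /=; rewrite /mk_path /concat_fun /= /rev_fun /=.
  case: leP => ht; first by rewrite min_l//; lra.
  rewrite min_r; last by lra.
  by rewrite clampr_id; [congr (f (clamp _)); lra|have /= := val01 t; lra].
- by move=> t; rewrite clamp0E// path_zero.
Qed.

Lemma concat_rev_l f : path_homotopic (loop_concat (loop_rev f) f) loop_cst.
Proof.
apply: (homotopic_eq (g := fun=> f (clamp 1))); first apply:
  (@homotopic_reparam f (fun x => Num.max (1 - 2 * x) (2 * x - 1)) (fun=> 1)).
- by apply: cont_max; cts.
- exact: cont_cst.
- by rewrite mulr0 subr0 sub0r max_l//; lra.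
- by rewrite mulr1 max_r; [congr (clamp _); lra|lra].
- by rewrite mulr0 subr0 sub0r max_l ?clamp1E ?path_one//; lra.
- by rewrite mulr1 max_r; [rewrite clamp1E ?path_one//; lra|lra].
- move=> t /=; rewrite /mk_path /concat_fun /= /rev_fun /=.
  case: leP => ht; last by rewrite max_r//; lra.
  rewrite max_l; last by lra.
  by rewrite clampr_id//; have /= := val01 t; lra.
- by move=> t; rewrite clamp1E// path_one.
Qed.

Lemma concatA f g h :
  path_homotopic (loop_concat f (loop_concat g h))
                 (loop_concat (loop_concat f g) h).
Proof.
apply: homotopic_sym.
apply: (homotopic_eq (@homotopic_reparam_id (loop_concat f (loop_concat g h))
  (fun x => Num.min (2 * x) (Num.min (x + 4^-1) (x / 2 + 2^-1))) _ _ _)) => //.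
- by apply: cont_min; [|apply: cont_min]; cts.
- by rewrite clamp0E// ge_min; apply/orP; left; lra.
- by rewrite clamp1E// !le_min; lra.
- move=> t; rewrite /= /mk_path /concat_fun /= /mk_path /concat_fun /=.
  have /= := val01 t; move: (sval t) => x x01.
  have [h1|h1] := leP x 2^-1; last first.
    have -> : Num.min (2 * x) (Num.min (x + 4^-1) (x / 2 + 2^-1)) = x / 2 + 2^-1.
      by rewrite !minEle; do ?case: ifP; lra.
    rewrite clampr_id; last by lra.
    rewrite ifN; last by rewrite -ltNge; lra.
    rewrite clampr_id; last by lra.
    rewrite ifN; last by rewrite -ltNge; lra.
    by congr (h (clamp _)); lra.
  rewrite (@clampr_id _ (2 * x)); last by lra.
  have [h2|h2] := leP (2 * x) 2^-1.
    have -> : Num.min (2 * x) (Num.min (x + 4^-1) (x / 2 + 2^-1)) = 2 * x.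
      by rewrite !minEle; do ?case: ifP; lra.
    by rewrite clampr_id ?h2//; lra.
  have -> : Num.min (2 * x) (Num.min (x + 4^-1) (x / 2 + 2^-1)) = x + 4^-1.
    by rewrite !minEle; do ?case: ifP; lra.
  rewrite clampr_id; last by lra.
  rewrite ifN; last by rewrite -ltNge; lra.
  rewrite clampr_id; last by lra.
  rewrite ifT; last by lra.
  by congr (g (clamp _)); lra.
Qed.

Definition homotopicb f g : bool := `[< path_homotopic f g >].

Lemma homotopicb_equiv : equiv_class_of homotopicb.
Proof.
split=> [f|f g|f g h].
- by apply/asboolP; exact: homotopic_refl.
- by apply/asboolP/asboolP; exact: homotopic_sym.
- by move=> /asboolP fg /asboolP gh; apply/asboolP; exact: homotopic_trans gh.
Qed.

Canonical homotopicb_equivRel := EquivRelPack homotopicb_equiv.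
Canonical homotopicb_encModRel := defaultEncModRel homotopicb.

Definition fundamental_group : Type := {eq_quot homotopicb}.

HB.instance Definition _ := EqQuotient.on fundamental_group.
HB.instance Definition _ := Choice.on fundamental_group.

Lemma pi1P f g : reflect (path_homotopic f g)
  (\pi_fundamental_group f == \pi_fundamental_group g).
Proof. by rewrite piE; exact: asboolP. Qed.

Definition pi1_one : fundamental_group := \pi_fundamental_group loop_cst.
Definition pi1_mul (a b : fundamental_group) : fundamental_group :=
  \pi_fundamental_group (loop_concat (repr a) (repr b)).
Definition pi1_inv (a : fundamental_group) : fundamental_group :=
  \pi_fundamental_group (loop_rev (repr a)).

Lemma repr_homotopic f : path_homotopic (repr (\pi_fundamental_group f)) f.
Proof. by apply/pi1P; rewrite reprK. Qed.

Lemma pi1_mulE f g :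
  pi1_mul (\pi_fundamental_group f) (\pi_fundamental_group g) =
  \pi_fundamental_group (loop_concat f g).
Proof. by apply/eqP/pi1P/concat_homotopic; exact: repr_homotopic. Qed.

Lemma pi1_invE f :
  pi1_inv (\pi_fundamental_group f) = \pi_fundamental_group (loop_rev f).
Proof. by apply/eqP/pi1P/rev_homotopic; exact: repr_homotopic. Qed.

Lemma pi1_mulA : associative pi1_mul.
Proof.
elim/quotW=> f; elim/quotW=> g; elim/quotW=> h.
rewrite (pi1_mulE g h) (pi1_mulE f g) (pi1_mulE f (loop_concat g h)).
by rewrite (pi1_mulE (loop_concat f g) h); apply/eqP/pi1P; exact: concatA.
Qed.

Lemma pi1_mul1 : left_id pi1_one pi1_mul.
Proof.
elim/quotW=> f; rewrite (pi1_mulE loop_cst f).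
by apply/eqP/pi1P; exact: concat_cst_l.
Qed.

Lemma pi1_mulr1 : right_id pi1_one pi1_mul.
Proof.
elim/quotW=> f; rewrite (pi1_mulE f loop_cst).
by apply/eqP/pi1P; exact: concat_cst_r.
Qed.

Lemma pi1_mulV : left_inverse pi1_one pi1_inv pi1_mul.
Proof.
elim/quotW=> f; rewrite (pi1_invE f) (pi1_mulE (loop_rev f) f).
by apply/eqP/pi1P; exact: concat_rev_l.
Qed.

Lemma pi1_mulrV : right_inverse pi1_one pi1_inv pi1_mul.
Proof.
elim/quotW=> f; rewrite (pi1_invE f) (pi1_mulE f (loop_rev f)).
by apply/eqP/pi1P; exact: concat_rev_r.
Qed.

HB.instance Definition _ := isGroup.Build fundamental_group
  pi1_mulA pi1_mul1 pi1_mulr1 pi1_mulV pi1_mulrV.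

End Loops.

Section Knots.
Variable R : realType.

Definition sphere3 : set 'rV[R]_4 := [set x | \sum_i x ord0 i ^+ 2 = 1].

(* A knot is a smoothly embedded circle.  The embedding is given by a 1-periodic
   smooth parametrization [c] of nowhere vanishing velocity which is injective
   modulo periods. *)
Definition is_knot (K : set 'rV[R]_4) : Prop :=
  exists c : R -> 'rV[R]_4,
    [/\ forall (i : 'I_4) (m : nat) (s : R),
          derivable (derive1n m (fun x => c x ord0 i)) s 1,
        forall s, exists i : 'I_4, derive1 (fun x => c x ord0 i) s != 0,
        forall s s', c s = c s' <-> exists m : int, s = s' + m%:~R,
        K `<=` sphere3
      & K = range c].

Definition knot_exterior (K : set 'rV[R]_4) : topologicalType :=
  set_type (sphere3 `\` K).

Definition knot_group (K : set 'rV[R]_4) (x0 : knot_exterior K) : groupType :=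
  fundamental_group R x0.

End Knots.

Section Words.

(* A word represents an element of the free group F on g_0, .., g_(n-1): the letter
   (i, false) stands for g_i and (i, true) for g_i^-1. *)
Definition word (n : nat) : Type := seq ('I_n * bool).

Definition winv n (w : word n) : word n := rev [seq (x.1, ~~ x.2) | x <- w].

Definition weval (G : groupType) n (g : 'I_n -> G) (w : word n) : G :=
  (\prod_(x <- w) (if x.2 then (g x.1)^-1 else g x.1))%g.

(* The words representing an element of the normal closure of the relators in F;
   [Ninsert] and [Ncancel] make the predicate invariant under free equivalence. *)
Inductive normal_closure n m (r : 'I_m -> word n) : word n -> Prop :=
| Nrel j : normal_closure r (r j)
| Nnil : normal_closure r [::]
| Ncat u v : normal_closure r u -> normal_closure r v -> normal_closure r (u ++ v)
| Ninv u : normal_closure r u -> normal_closure r (winv u)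
| Nconj u w : normal_closure r u -> normal_closure r (w ++ u ++ winv w)
| Ninsert u v w : normal_closure r (u ++ v) ->
    normal_closure r (u ++ (w ++ winv w) ++ v)
| Ncancel u v w : normal_closure r (u ++ (w ++ winv w) ++ v) ->
    normal_closure r (u ++ v).

Definition is_presentation (G : groupType) n m
    (g : 'I_n -> G) (r : 'I_m -> word n) : Prop :=
  (forall x, exists w, x = weval g w) /\
  (forall w, weval g w = 1%g <-> normal_closure r w).

(* Formal sums representing elements of Z[F].  The representation is not unique, but
   it is only used through [ZF_ext], the linear extension of a map on words. *)
Definition ZF (n : nat) : Type := seq (int * word n).

Definition ZF_ext n (M : zmodType) (f : word n -> M) (c : ZF n) : M :=
  \sum_(p <- c) f p.2 *~ p.1.

(* The Fox derivative, as the derivation with product rule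
     d(uv)/dg_i = (du/dg_i) v + dv/dg_i,
   hence sum_i (g_i - 1) dw/dg_i = w - 1.  The mirror-image rule
   d(uv) = du + u dv gives sum_i dw/dg_i (g_i - 1) = w - 1 instead.  The former order
   of the factors is the one for which matrices acting on the left of column vectors
   satisfy d1 o d2 = 0 (lemma [twisted_d1_d2] below).  On a relator r the two
   derivatives D (used here) and D' are related in Z[G] by D r = g_i^-1 (D' r)^*,
   where * is the involution induced by x |-> x^-1. *)
Fixpoint fox n (i : 'I_n) (w : word n) : ZF n :=
  if w is x :: w' then
    (if x.1 == i then [:: if x.2 then (-1, x :: w') else (1, w')] else [::])
      ++ fox i w'
  else [::].

(* The last clause says that the kernel is contained in (hence equal to) the
   commutator subgroup. *)
Definition is_abelianization (G : groupType) (alpha : G -> int) : Prop :=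
  [/\ forall x y, alpha (x * y)%g = alpha x + alpha y,
      forall m, exists x, alpha x = m
    & forall x, alpha x = 0 -> forall S : {pred G}, group_closed S ->
        (forall a b, commg a b \in S) -> x \in S].

End Words.

Section Rings.

Definition is_ideal (A : comNzRingType) (I : set A) : Prop :=
  [/\ I 0, forall x y, I x -> I y -> I (x + y) & forall a x, I x -> I (a * x)].

Definition ideal_span (A : comNzRingType) (s : seq A) : set A :=
  [set x | exists c : 'I_(size s) -> A, x = \sum_i c i * s`_i].

Definition noetherian (A : comNzRingType) : Prop :=
  forall I : set A, is_ideal I -> exists s, I = ideal_span s.

Definition ideal_mul (A : comNzRingType) (I J : set A) : set A :=
  [set x | exists s : seq (A * A),
     (forall p, p \in s -> I p.1 /\ J p.2) /\ x = \sum_(p <- s) p.1 * p.2].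

(* I^0 is the unit ideal. *)
Definition ideal_exp (A : comNzRingType) (I : set A) (n : nat) : set A :=
  iter n (ideal_mul I) setT.

(* The map from A to the inverse limit of the A / I^n is injective and surjective. *)
Definition adically_complete (A : comNzRingType) (I : set A) : Prop :=
  (forall x, (forall n, ideal_exp I n x) -> x = 0) /\
  (forall u : nat -> A, (forall n, ideal_exp I n (u n.+1 - u n)) ->
     exists x, forall n, ideal_exp I n (x - u n)).

Definition nonunits (A : comUnitRingType) : set A :=
  [set x | x \isn't a GRing.unit].

Definition local_ring (A : comUnitRingType) : Prop := is_ideal (@nonunits A).

(* A local principal ideal domain which is not a field. *)
Definition is_dvr (A : idomainType) : Prop :=
  [/\ forall I : set A, is_ideal I -> exists a, I = ideal_span [:: a],
      local_ring A
    & exists2 x : A, x != 0 & x \isn't a GRing.unit].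

Definition irreducible_elt (A : idomainType) (p : A) : Prop :=
  [/\ p != 0, p \isn't a GRing.unit
    & forall a b, p = a * b -> a \is a GRing.unit \/ b \is a GRing.unit].

Definition associated (A : idomainType) (a b : A) : Prop :=
  exists2 u, u \is a GRing.unit & b = u * a.

Definition factorial_domain (A : idomainType) : Prop :=
  (forall x : A, x != 0 -> x \isn't a GRing.unit ->
     exists s : seq A,
       (forall p, p \in s -> irreducible_elt p) /\ x = \prod_(p <- s) p) /\
  (forall s t : seq A,
     (forall p, p \in s -> irreducible_elt p) ->
     (forall p, p \in t -> irreducible_elt p) ->
     \prod_(p <- s) p = \prod_(p <- t) p ->
     exists t', [/\ perm_eq t t', size s = size t'
       & forall i, (i < size s)%N -> associated s`_i t'`_i]).

Definition perfect_field (k : fieldType) : Prop :=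
  forall p : {poly k}, irreducible_poly p -> separable_poly p.

End Rings.

Section Modules.

Definition finitely_generated (A : nzRingType) (M : lmodType A) : Prop :=
  exists s : seq M, forall x, exists c : 'I_(size s) -> A,
    x = \sum_i c i *: s`_i.

Definition torsion_module (A : idomainType) (M : lmodType A) : Prop :=
  forall x : M, exists2 a : A, a != 0 & a *: x = 0.

End Modules.

Section QuotientModule.
Variables (A : nzRingType) (V : lmodType A) (B : zmodClosed V).
Hypothesis scaleB : GRing.scaler_closed B.
Local Notation Q := (Quotient.quot B).

Definition qscale (a : A) (q : Q) : Q := \pi_Q (a *: repr q).

Lemma qscaleE a v : qscale a (\pi_Q v) = \pi_Q (a *: v).
Proof.
apply/eqP; rewrite -Quotient.idealrBE -scalerBr scaleB //.
by rewrite Quotient.idealrBE reprK.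
Qed.

Lemma qscaleA a b q : qscale a (qscale b q) = qscale (a * b) q.
Proof.
by elim/quotW: q => v; rewrite (qscaleE b v) (qscaleE a (b *: v)) qscaleE scalerA.
Qed.

Lemma qscale1 : left_id 1 qscale.
Proof. by elim/quotW=> v; rewrite qscaleE scale1r. Qed.

Lemma qscaleDr : right_distributive qscale +%R.
Proof.
move=> a; elim/quotW=> u; elim/quotW=> v.
by rewrite -pi_addr qscaleE (qscaleE a u) (qscaleE a v) scalerDr pi_addr.
Qed.

Lemma qscaleDl q : {morph qscale^~ q : a b / a + b}.
Proof.
elim/quotW: q => v a b.
by rewrite (qscaleE (a + b) v) (qscaleE a v) (qscaleE b v) scalerDl pi_addr.
Qed.

Definition quotient_module of GRing.scaler_closed B : Type := Q.
HB.instance Definition _ := GRing.Zmodule.on (quotient_module scaleB).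
HB.instance Definition _ := GRing.Zmodule_isLmodule.Build A (quotient_module scaleB)
  qscaleA qscale1 qscaleDr qscaleDl.

End QuotientModule.

Section Homology.
Variables (A : nzRingType) (U V W : lmodType A).
Variables (d2 : {linear U -> V}) (d1 : {linear V -> W}).

Definition is_cycle : {pred V} := [pred v | d1 v == 0].

Lemma is_cycle_submod : submod_closed is_cycle.
Proof.
split=> [|a u v]; rewrite !inE ?linear0// => /eqP du /eqP dv.
by rewrite linearP du dv scaler0 addr0.
Qed.

HB.instance Definition _ := GRing.isSubmodClosed.Build A V is_cycle is_cycle_submod.

Definition cycle_module : Type := {v : V | is_cycle v}.
HB.instance Definition _ := [isSub of cycle_module for @sval V is_cycle].
HB.instance Definition _ := [Choice of cycle_module by <:].
HB.instance Definition _ := [SubChoice_isSubLmodule of cycle_module by <:].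

(* When d1 o d2 = 0, this is the image of d2. *)
Definition is_boundary : {pred cycle_module} :=
  [pred z | `[< exists u, d2 u = val z >]].

Lemma is_boundary_submod : submod_closed is_boundary.
Proof.
split=> [|a x y].
  by apply/asboolP; exists 0; rewrite !linear0.
move=> /asboolP[u ux] /asboolP[v vy]; apply/asboolP; exists (a *: u + v).
by rewrite linearP ux vy.
Qed.

HB.instance Definition _ := GRing.isZmodClosed.Build cycle_module is_boundary
  (GRing.submod_closedB is_boundary_submod).

Lemma is_boundary_scaler : GRing.scaler_closed is_boundary.
Proof. exact: (GRing.subsemimod_closedZ is_boundary_submod). Qed.

Definition homology : lmodType A := quotient_module is_boundary_scaler.

End Homology.

Section Representations.
Variable G : groupType.

Record SL2rep (A : comNzRingType) : Type := SL2Rep {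
  SL2mx :> G -> 'M[A]_2;
  SL2mx1 : SL2mx 1%g = 1%:M;
  SL2mxM : forall x y, SL2mx (x * y)%g = SL2mx x *m SL2mx y;
  SL2mx_det : forall x, \det (SL2mx x) = 1
}.

Definition irreducible_rep (L : fieldType) (rho : G -> 'M[L]_2) : Prop :=
  forall U : {vspace 'cV[L]_2},
    (forall x v, v \in U -> rho x *m v \in U) -> U = 0%VS \/ U = fullv.

Definition absolutely_irreducible (k : fieldType) (rho : SL2rep k) : Prop :=
  exists (L : closedFieldType) (iota : {rmorphism k -> L}),
    (forall z, algebraicOver iota z) /\
    irreducible_rep (fun x => map_mx iota (rho x)).

Definition strictly_equivalent (A : comUnitRingType)
    (rho1 rho2 : G -> 'M[A]_2) : Prop :=
  exists gamma : 'M[A]_2,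
    (forall i j, nonunits ((gamma - 1%:M) i j)) /\
    (forall x, rho2 x = invmx gamma *m rho1 x *m gamma).

End Representations.

Section Deformations.
Variables (O : idomainType) (k : fieldType) (resO : {rmorphism O -> k}).

(* [res] identifies k with the residue field of the local ring A. *)
Definition residue_map (A : comUnitRingType) (res : A -> k) : Prop :=
  (forall y, exists x, res x = y) /\ (forall x, res x = 0 <-> nonunits x).

Definition complete_dvr_residue : Prop :=
  [/\ is_dvr O, adically_complete (@nonunits O) & residue_map resO].

(* The structure of a complete local O-algebra with residue field k. *)
Record CL_structure (A : comUnitRingType) : Type := CLStructure {
  CL_alg : {rmorphism O -> A};
  CL_res : {rmorphism A -> k};
  CL_local : local_ring A;
  CL_complete : adically_complete (@nonunits A);
  CL_residue : residue_map CL_res;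
  CL_compat : forall a, CL_res (CL_alg a) = resO a
}.

Definition CL_morphism (A B : comUnitRingType)
    (cA : CL_structure A) (cB : CL_structure B) (f : {rmorphism A -> B}) : Prop :=
  (forall a, f (CL_alg cA a) = CL_alg cB a) /\
  (forall x, CL_res cB (f x) = CL_res cA x).

Variables (G : groupType) (rhobar : SL2rep G k).

Definition is_deformation (A : comUnitRingType) (cA : CL_structure A)
    (rho : SL2rep G A) : Prop :=
  forall x, map_mx (CL_res cA) (rho x) = rhobar x.

Definition is_universal_deformation (A : comUnitRingType) (cA : CL_structure A)
    (rho : SL2rep G A) : Prop :=
  is_deformation cA rho /\
  forall (B : comUnitRingType) (cB : CL_structure B) (rho' : SL2rep G B),
    is_deformation cB rho' ->
    exists psi : {rmorphism A -> B},
      [/\ CL_morphism cA cB psi,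
          strictly_equivalent (fun x => map_mx psi (rho x)) rho'
        & forall psi' : {rmorphism A -> B}, CL_morphism cA cB psi' ->
            strictly_equivalent (fun x => map_mx psi' (rho x)) rho' ->
            psi' =1 psi].

End Deformations.

Section TwistedKnotModule.
Variables (G : groupType) (A : comNzRingType) (rho : SL2rep G A).
Variables (n m : nat) (g : 'I_n -> G) (r : 'I_m -> word n).

Definition twisted_d1 (v : {ffun 'I_n -> 'cV[A]_2}) : 'cV[A]_2 :=
  \sum_i (rho (g i) - 1%:M) *m v i.

Definition rho_fox (i : 'I_n) (w : word n) : 'M[A]_2 :=
  ZF_ext (fun w => rho (weval g w)) (fox i w).

Definition twisted_d2 (u : {ffun 'I_m -> 'cV[A]_2}) : {ffun 'I_n -> 'cV[A]_2} :=
  [ffun i => \sum_j rho_fox i (r j) *m u j].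

Lemma twisted_d1_linear : linear twisted_d1.
Proof.
move=> a u v; rewrite /twisted_d1 scaler_sumr -big_split; apply: eq_bigr => i _.
by rewrite !ffunE mulmxDr scalemxAr.
Qed.

Lemma twisted_d2_linear : linear twisted_d2.
Proof.
move=> a u v; apply/ffunP => i; rewrite !ffunE scaler_sumr -big_split.
by apply: eq_bigr => j _; rewrite !ffunE mulmxDr scalemxAr.
Qed.

HB.instance Definition _ := GRing.isLinear.Build A _ _ _ twisted_d1 twisted_d1_linear.
HB.instance Definition _ := GRing.isLinear.Build A _ _ _ twisted_d2 twisted_d2_linear.

Definition twisted_H1 : lmodType A := homology twisted_d2 twisted_d1.

Lemma ZF_ext_cat (M : zmodType) (f : word n -> M) c d :
  ZF_ext f (c ++ d) = ZF_ext f c + ZF_ext f d.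
Proof. exact: big_cat. Qed.

Lemma weval_cons x (w : word n) :
  weval g (x :: w) = ((if x.2 then (g x.1)^-1 else g x.1) * weval g w)%g.
Proof. exact: big_cons. Qed.

Lemma fox_fundamental (w : word n) :
  \sum_i (rho (g i) - 1%:M) *m rho_fox i w = rho (weval g w) - 1%:M.
Proof.
elim: w => [|x w IH].
  rewrite /weval big_nil SL2mx1 subrr big1// => i _.
  by rewrite /rho_fox /ZF_ext big_nil mulmx0.
under eq_bigr => i _ do rewrite /rho_fox /= ZF_ext_cat mulmxDr.
rewrite big_split /= {}IH (bigD1 x.1)//= eqxx [X in _ + X + _]big1 => [|i]; last first.
  by rewrite eq_sym => /negPf ->; rewrite /ZF_ext big_nil mulmx0.
rewrite addr0 weval_cons /ZF_ext big_seq1; case: x => i [] /=.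
  rewrite mulrN1z mulmxN weval_cons /= mulmxBl mul1mx -SL2mxM mulVKg opprB.
  by rewrite addrA subrK.
by rewrite mulr1z mulmxBl mul1mx -SL2mxM addrA subrK.
Qed.

Lemma twisted_d1_d2 u : (forall j, weval g (r j) = 1%g) ->
  twisted_d1 (twisted_d2 u) = 0.
Proof.
move=> rel; rewrite /twisted_d1.
under eq_bigr => i _ do rewrite ffunE mulmx_sumr.
rewrite exchange_big big1// => j _.
under eq_bigr => i _ do rewrite mulmxA.
by rewrite -mulmx_suml fox_fundamental rel SL2mx1 subrr mul0mx.
Qed.

End TwistedKnotModule.

Section AlexanderInvariant.
Variable A : idomainType.
(* The field of fractions of A[t] is Q(A)(t), and [laurent] below is A[t, t^-1]. *)
Local Notation At := {fraction {poly A}}.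

Definition laurent : set At :=
  [set x | exists (p : {poly A}) (d : nat), x = tofrac p / tofrac 'X^d].

Definition laurent_dvd (x y : At) : Prop := exists2 z, laurent z & y = z * x.

Definition is_laurent_gcd (S : set At) (D : At) : Prop :=
  [/\ laurent D, forall x, S x -> laurent_dvd D x
    & forall e, laurent e -> (forall x, S x -> laurent_dvd e x) -> laurent_dvd e D].

Definition minors (p q d : nat) (M : 'M[At]_(p, q)) : set At :=
  [set x | exists (f : 'I_d -> 'I_p) (h : 'I_d -> 'I_q),
     [/\ {homo f : i j / (i < j)%N}, {homo h : i j / (i < j)%N}
       & x = \det (mxsub f h M)]].

(* The rational function [f] is regular at t = 1, with value [c]. *)
Definition value_at1 (f : At) (c : {fraction A}) : Prop :=
  exists p q : {poly A},
    [/\ q.[1] != 0, f = tofrac p / tofrac q & c = tofrac p.[1] / tofrac q.[1]].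

Variables (G : groupType) (rho : SL2rep G A) (alpha : G -> int).
Variables (n : nat) (g : 'I_n.+1 -> G) (r : 'I_n -> word n.+1).

(* The value at a group element of the tensor product of [rho] and [alpha]. *)
Definition Phi (x : G) : 'M[At]_2 :=
  exprz (tofrac 'X) (alpha x) *: map_mx (fun a : A => tofrac a%:P) (rho x).

Definition Phi_fox (i : 'I_n.+1) (j : 'I_n) : 'M[At]_2 :=
  ZF_ext (fun w => Phi (weval g w)) (fox i (r j)).

(* The block matrix of the [Phi_fox] with the i-th block row deleted. *)
Definition alexander_matrix (i : 'I_n.+1) : 'M[At]_(\sum_(l < n) 2, \sum_(j < n) 2) :=
  \mxblock_(l < n, j < n) Phi_fox (lift i l) j.

Definition is_twisted_alexander (Delta : At) : Prop :=
  exists (i : 'I_n.+1) (D : At),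
    [/\ \det (Phi (g i) - 1%:M) != 0,
        is_laurent_gcd (minors (n * 2) (alexander_matrix i)) D
      & Delta = D / \det (Phi (g i) - 1%:M)].

End AlexanderInvariant.

(* Main.v *)
Require Import Defs.
From HB Require Import structures.
From mathcomp Require Import all_boot all_order all_algebra.
From mathcomp Require Import perm fraction generic_quotient ring_quotient.
From mathcomp Require Import all_classical all_reals all_analysis.
Import Order.TTheory GRing.Theory Num.Theory.

Local Open Scope classical_set_scope.
Local Open Scope ring_scope.

Set Implicit Arguments.
Unset Strict Implicit.
Unset Printing Implicit Defensive.

(** Finite generation: the module of 1-cycles is a submodule of a free module of
    finite rank over a Noetherian ring, and H_1 is a quotient of it
    ([twisted_H1_finitely_generated]).

    Torsion: the presentation has one relator fewer than generators, so the Fox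
    Jacobian of the relators is one block column short of being square.  Fill the
    gap with the Fox derivatives of a word w, as if w were one more relator; this
    is the matrix [bordered_fox].  By the fundamental formula of Fox calculus the
    row of the phi(g_a) - 1 multiplies it to the row which is zero except for the
    entry phi(w) - 1 under w.  This has two consequences.

    - If the determinant d of the bordered matrix and det(phi(w) - 1) are nonzero
      in a domain, then d kills H_1 ([twisted_H1_torsion]).  By Cramer's rule, d v
      is, for each cycle v, a combination of the columns of the bordered matrix;
      applying d_1 to it shows that the coefficient b of the column of w satisfies
      (phi(w) - 1) b = 0.  Hence b = 0 and d v is a boundary.

    - The determinant of the bordered matrix is det(phi(w) - 1) times the
      determinant of the Jacobian without its i-th row, divided by
      det(phi(g_i) - 1) ([det_bordered_fox]).  Applied to the tensor product of rho
      and alpha, this says that Delta * det(Phi(w) - 1) is the determinant of the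
      bordered matrix up to a factor in A[t, 1/t].  All terms can be evaluated at
      t = 1, where the left-hand side is Delta(1) * det(rho(w) - 1)
      ([det_bordered_fox_neq0]).  The word w has to be chosen freely because
      det(rho(g_i) - 1) may vanish although det(Phi(g_i) - 1) does not.

    So for the deformation rho of the hypothesis and a word w representing the
    given group element, both determinants are nonzero.  They are invariant under
    conjugation and commute with ring morphisms, and rho is conjugate to the image
    of the universal deformation under a ring morphism psi.  Thus psi does not kill
    the determinants of the universal deformation, and these are nonzero too. *)

(** * Finite generation over a Noetherian ring *)

Section NoetherianModules.
Variables (A : comNzRingType) (M : lmodType A).

(** A module embeds in a free module of finite rank as soon as finitely many linear
    forms separate its points, and in this form the usual induction on the rank
    stays inside M: the values of the first form on S make up a finitely generated
    ideal, and subtracting a combination of preimages of its generators moves an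
    element of S to the kernel of that form, where the other forms suffice. *)
Lemma submodule_finitely_generated d (f : 'I_d -> {scalar M}) (S : set M) :
  noetherian A -> S 0 -> (forall a x y, S x -> S y -> S (a *: x + y)) ->
  (forall x, S x -> (forall i, f i x = 0) -> x = 0) ->
  exists m (y : 'I_m -> M), forall x, S x -> exists c : 'I_m -> A,
    x = \sum_i c i *: y i.
Proof.
move=> noethA; elim: d f S => [|d IH] fs S S0 SP inj.
  exists 0, (fun=> 0) => x Sx; exists (fun=> 0); rewrite big_ord0.
  by apply: inj => // -[].
set f := fs ord0.
have SZ a x : S x -> S (a *: x) by move=> Sx; rewrite -[_ *: _]addr0; exact: SP.
have [//|||m' [y' y'P]] := IH (fun i => fs (lift ord0 i)) [set x | S x /\ f x = 0].
- by split=> //; rewrite linear0.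
- move=> a x y [Sx fx] [Sy fy]; split; first exact: SP.
  by rewrite linearP fx fy mulr0 addr0.
- move=> x [Sx fx] fsx; apply: inj => // i.
  by have [j ->|->] := unliftP ord0 i; [exact: fsx|].
have [|s sP] := noethA (f @` S).
  split; first by exists 0; rewrite ?linear0.
  - move=> _ _ [x Sx <-] [y Sy <-]; exists (x + y); last by rewrite linearD.
    by rewrite -[x]scale1r; exact: SP.
  - by move=> a _ [x Sx <-]; exists (a *: x); [exact: SZ|rewrite linearZ].
have /choice[y yP] : forall i : 'I_(size s), exists y, S y /\ f y = s`_i.
  move=> i; suff [y Sy fy] : (f @` S) s`_i by exists y.
  rewrite sP; exists (fun j => (j == i)%:R).
  rewrite (bigD1 i)//= eqxx mul1r big1 ?addr0// => j /negPf ->.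
  by rewrite mul0r.
exists (size s + m')%N, (fun i : 'I_(size s + m') =>
  match fintype.split i with inl j => y j | inr j => y' j end).
move=> x Sx; have : (f @` S) (f x) by exists x.
rewrite sP => -[c fxE].
have Sy : S (\sum_i c i *: y i).
  elim/big_ind: _ => // [u v Su Sv|i _].
    by rewrite -[u]scale1r; exact: SP.
  by apply: SZ; case: (yP i).
have [|c' c'P] := y'P (x - \sum_i c i *: y i).
  split; first by rewrite addrC -scaleN1r; exact: SP.
  rewrite linearB linear_sum fxE -sumrB big1// => i _.
  by rewrite linearZ /= (yP i).2 subrr.
exists (fun i : 'I_(size s + m') =>
  match fintype.split i with inl j => c j | inr j => c' j end).
rewrite big_split_ord /= -[LHS](subrK (\sum_i c i *: y i)) c'P [LHS]addrC.
congr (_ + _); apply: eq_bigr => i _.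
  by rewrite -[lshift m' i]/(unsplit (inl i)) unsplitK.
by rewrite -[rshift (size s) i]/(unsplit (inr i)) unsplitK.
Qed.

Lemma finitely_generated_ord m (y : 'I_m -> M) :
  (forall x, exists c : 'I_m -> A, x = \sum_i c i *: y i) -> finitely_generated M.
Proof.
move=> yP; exists (codom y) => x; have [c ->] := yP x.
have e : size (codom y) = m by rewrite size_codom card_ord.
exists (fun i => c (cast_ord e i)).
rewrite (reindex (cast_ord e)) /=; last first.
  by exists (cast_ord (esym e)) => i _; rewrite ?cast_ordK ?cast_ordKV.
apply: eq_bigr => i _; congr (_ *: _).
have i' : (val i < #|'I_m|)%N by rewrite card_ord (leq_trans (ltn_ord i)) ?e.
rewrite (nth_map (cast_ord e i)); last by rewrite -cardE.
by congr y; apply: val_inj; rewrite /= nth_enum_ord// (leq_trans (ltn_ord i)) ?e.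
Qed.

End NoetherianModules.

Section FinitelyGeneratedH1.
Local Open Scope quotient_scope.
Variables (G : groupType) (A : comNzRingType) (rho : SL2rep G A).
Variables (n m : nat) (g : 'I_n -> G) (r : 'I_m -> word n).

Lemma twisted_H1_finitely_generated :
  noetherian A -> finitely_generated (twisted_H1 rho g r).
Proof.
move=> noethA.
pose Z := cycle_module (twisted_d1 rho g).
pose f (p : 'I_n * 'I_2) (z : Z) : A^o := val z p.1 p.2 ord0.
have fL p : linear (f p) by move=> a u v; rewrite /f linearP !ffunE !mxE.
pose F p : {scalar Z} := HB.pack (f p) (GRing.isLinear.Build _ _ _ _ _ (fL p)).
have F_inj (z : Z) : setT z ->
    (forall l : 'I_#|{: 'I_n * 'I_2}|, F (enum_val l) z = 0) -> z = 0.
  move=> _ zP; apply: val_inj; apply/ffunP => i; apply/matrixP => j l.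
  rewrite [val 0]linear0 !ffunE !mxE !(ord1 l).
  by have := zP (enum_rank (i, j)); rewrite enum_rankK.
have [//|N [y yP]] := submodule_finitely_generated noethA I _ F_inj.
pose p (z : Z) : twisted_H1 rho g r := \pi_(Quotient.quot _) z.
apply: (@finitely_generated_ord _ _ N (fun i => p (y i))).
elim/quotW => z; have [//|c ->] := yP z; exists c.
have pD : {morph p : u v / u + v} by move=> u v; exact: raddfD.
have p0 : p 0 = 0 by exact: raddf0.
rewrite -[LHS]/(p _) (big_morph p pD p0); apply: eq_bigr => i _.
by symmetry; apply: qscaleE; exact: is_boundary_scaler.
Qed.
End FinitelyGeneratedH1.

(** * Fox calculus *)

Lemma raddf_ZF_ext n (M M' : zmodType) (f : {additive M -> M'}) (h : word n -> M) c :
  f (ZF_ext h c) = ZF_ext (f \o h) c.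
Proof. by rewrite raddf_sum; apply: eq_bigr => p _; rewrite raddfMz. Qed.

Lemma eq_ZF_ext n (M : zmodType) (h h' : word n -> M) c :
  h =1 h' -> ZF_ext h c = ZF_ext h' c.
Proof. by move=> hh'; apply: eq_bigr => p _; rewrite hh'. Qed.

Section FoxJacobian.
Variables (G : groupType) (C : comNzRingType) (phi : G -> 'M[C]_2).
Variables (n : nat) (g : 'I_n.+1 -> G).

Definition fox_mx (a : 'I_n.+1) (w : word n.+1) : 'M[C]_2 :=
  ZF_ext (fun u => phi (weval g u)) (fox a w).

(** The Fox Jacobian of the relators without its i-th block row. *)
Definition minor_fox (r : 'I_n -> word n.+1) (i : 'I_n.+1) :=
  \mxblock_(l < n, j < n) fox_mx (lift i l) (r j).

(** The Fox Jacobian of the words w, r_0, .., r_(n-1).  The i-th generator comes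
    first, so that deleting the border leaves [minor_fox]. *)
Definition bordered_fox (r : 'I_n -> word n.+1) (i : 'I_n.+1) (w : word n.+1) :
    'M[C]_(2 + \sum_(l < n) 2) :=
  block_mx (fox_mx i w) (\mxrow_j fox_mx i (r j))
           (\mxcol_l fox_mx (lift i l) w) (minor_fox r i).

(** The identity matrix with its first block row replaced by d_1.  It makes the
    fundamental formula a product of square matrices, to which determinants
    apply. *)
Definition boundary_mx (i : 'I_n.+1) : 'M[C]_(2 + \sum_(l < n) 2) :=
  block_mx (phi (g i) - 1%:M) (\mxrow_l (phi (g (lift i l)) - 1%:M)) 0 1%:M.

Hypotheses (phi1 : phi 1%g = 1%:M) (phiM : {morph phi : x y / (x * y)%g >-> x *m y}).

Lemma fox_mx_fundamental w :
  \sum_a (phi (g a) - 1%:M) *m fox_mx a w = phi (weval g w) - 1%:M.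
Proof.
elim: w => [|[b e] w IH].
  rewrite /weval big_nil phi1 subrr big1// => a _.
  by rewrite /fox_mx /ZF_ext big_nil mulmx0.
under eq_bigr => a _ do rewrite /fox_mx /= ZF_ext_cat mulmxDr.
rewrite big_split /= {}IH (bigD1 b)//= eqxx [X in _ + X + _]big1 => [|a]; last first.
  by rewrite eq_sym => /negPf ->; rewrite /ZF_ext big_nil mulmx0.
rewrite addr0 weval_cons /ZF_ext big_seq1; case: e => /=.
  rewrite mulrN1z mulmxN weval_cons /= mulmxBl mul1mx -phiM mulVKg opprB.
  by rewrite addrA subrK.
by rewrite mulr1z mulmxBl mul1mx -phiM addrA subrK.
Qed.

(** The first block row consists of the values at w, r_0, .., r_(n-1) of the
    fundamental formula, and a relator evaluates to 1. *)
Lemma boundary_bordered_fox (r : 'I_n -> word n.+1) i w :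
  (forall j, weval g (r j) = 1%g) ->
  boundary_mx i *m bordered_fox r i w =
  block_mx (phi (weval g w) - 1%:M) 0
           (\mxcol_l fox_mx (lift i l) w) (minor_fox r i).
Proof.
move=> rel; have fund u : (phi (g i) - 1%:M) *m fox_mx i u +
    \sum_l (phi (g (lift i l)) - 1%:M) *m fox_mx (lift i l) u = phi (weval g u) - 1%:M.
  by rewrite -fox_mx_fundamental (bigD1_ord i).
rewrite mulmx_block !mul0mx !mul1mx !add0r mul_mxrow_mxcol fund; congr block_mx.
rewrite mul_mxrow mul_mxrow_mxblock -mxrowD -[RHS]mxrow0.
by apply: eq_mxrow => j; rewrite fund rel phi1 subrr.
Qed.

(** Determinants in [boundary_bordered_fox].  This is the exact form of the
    independence of the twisted Alexander invariant from the deleted generator. *)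
Lemma det_bordered_fox (r : 'I_n -> word n.+1) i w :
  (forall j, weval g (r j) = 1%g) ->
  \det (phi (g i) - 1%:M) * \det (bordered_fox r i w) =
  \det (phi (weval g w) - 1%:M) * \det (minor_fox r i).
Proof.
move=> rel; rewrite -(det_lblock _ (\mxcol_l fox_mx (lift i l) w)).
by rewrite -boundary_bordered_fox// det_mulmx det_ublock det1 mulr1.
Qed.

End FoxJacobian.

(** The Fox derivatives are conjugated by gamma too, so the bordered matrix is
    conjugated by the block diagonal matrix with blocks gamma. *)
Lemma det_bordered_fox_conj (G : groupType) (C : comUnitRingType)
    (phi phi' : G -> 'M[C]_2) n (g : 'I_n.+1 -> G) r i w (gamma : 'M[C]_2) :
  gamma \in unitmx -> (forall x, phi' x = invmx gamma *m phi x *m gamma) ->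
  \det (bordered_fox phi' g r i w) = \det (bordered_fox phi g r i w).
Proof.
move=> gU phi'E.
have foxE a u : fox_mx phi' g a u = invmx gamma *m fox_mx phi g a u *m gamma.
  rewrite -[RHS]/((mulmxr gamma \o mulmx (invmx gamma)) _) raddf_ZF_ext.
  by apply: eq_ZF_ext => v /=; rewrite phi'E.
pose D (c : 'M[C]_2) := block_mx c 0 0 (\mxdiag_(l < n) c).
have DD : \det (D (invmx gamma)) * \det (D gamma) = 1.
  rewrite -det_mulmx mulmx_block !mul0mx !mulmx0 !addr0 !add0r mulVmx//.
  rewrite [X in block_mx _ _ _ X](_ : _ = 1%:M) -?scalar_mx_block ?det1//.
  rewrite -mxdiagZ {2}/mxdiag mul_mxdiag_mxblock; apply: eq_mxblock => a b.
  by case: eqP => _; rewrite ?conform_mx_id ?mulmx0 ?mulVmx.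
have -> : bordered_fox phi' g r i w =
    D (invmx gamma) *m bordered_fox phi g r i w *m D gamma.
  rewrite /bordered_fox /minor_fox !mulmx_block !mul0mx !mulmx0 !addr0 !add0r foxE.
  rewrite mul_mxrow mul_mxrow_mxdiag mul_mxdiag_mxcol mxcol_mul.
  rewrite mul_mxdiag_mxblock mul_mxblock_mxdiag.
  congr block_mx; first exact: eq_mxrow.
    exact: eq_mxcol.
  exact: eq_mxblock.
by rewrite !det_mulmx mulrAC DD mul1r.
Qed.

Lemma map_bordered_fox (G : groupType) (C C' : comNzRingType) (f : {rmorphism C -> C'})
    (phi : G -> 'M[C]_2) n (g : 'I_n.+1 -> G) r i w :
  map_mx f (bordered_fox phi g r i w) = bordered_fox (fun x => map_mx f (phi x)) g r i w.
Proof.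
have foxE a u : map_mx f (fox_mx phi g a u) = fox_mx (fun x => map_mx f (phi x)) g a u.
  exact: raddf_ZF_ext.
rewrite map_block_mx foxE.
by congr block_mx; apply/matrixP => a b; rewrite !mxE -foxE mxE.
Qed.

(** * Evaluation at t = 1, and Laurent polynomials *)

Section Values.
Variable A : idomainType.
Local Notation At := {fraction {poly A}}.

Lemma tofrac_horner_neq0 (s : {poly A}) : s.[1] != 0 -> tofrac s != 0.
Proof. by rewrite tofrac_eq0; apply: contraNneq => ->; rewrite horner0. Qed.

(** This and the following lemmas say that [value_at1] is a ring morphism defined on
    a subring of Q(A)(t), while avoiding the construction of that subring. *)
Lemma value_at1_uniq (f : At) c c' : value_at1 f c -> value_at1 f c' -> c = c'.
Proof.
move=> [p [q [q1 -> ->]]] [p' [q' [q1' e ->]]].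
apply/eqP; rewrite eqr_div ?tofrac_eq0// -!tofracM tofrac_eq -!hornerM.
move/eqP: e; rewrite eqr_div ?tofrac_horner_neq0// -!tofracM tofrac_eq => /eqP ->.
exact: eqxx.
Qed.

Lemma value_at1_poly (p : {poly A}) : value_at1 (tofrac p) (tofrac p.[1]).
Proof. by exists p, 1; rewrite hornerE oner_eq0 !tofrac1 !divr1. Qed.

Lemma value_at1_0 : value_at1 (0 : At) 0.
Proof. by have := value_at1_poly 0; rewrite horner0 !tofrac0. Qed.

Lemma value_at1_1 : value_at1 (1 : At) 1.
Proof. by have := value_at1_poly 1; rewrite hornerE !tofrac1. Qed.

Lemma value_at1_add (f f' : At) c c' :
  value_at1 f c -> value_at1 f' c' -> value_at1 (f + f') (c + c').
Proof.
move=> [p [q [q1 -> ->]]] [p' [q' [q1' -> ->]]].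
exists (p * q' + p' * q), (q * q'); split.
- by rewrite hornerM mulf_neq0.
- by rewrite addf_div ?tofrac_horner_neq0// !(tofracD, tofracM).
- by rewrite !hornerE addf_div ?tofrac_eq0// !(tofracD, tofracM).
Qed.

Lemma value_at1_mul (f f' : At) c c' :
  value_at1 f c -> value_at1 f' c' -> value_at1 (f * f') (c * c').
Proof.
move=> [p [q [q1 -> ->]]] [p' [q' [q1' -> ->]]].
exists (p * p'), (q * q'); split.
- by rewrite hornerM mulf_neq0.
- by rewrite !tofracM mulf_div.
- by rewrite !hornerM !tofracM mulf_div.
Qed.

Lemma value_at1_opp (f : At) c : value_at1 f c -> value_at1 (- f) (- c).
Proof.
rewrite -mulN1r -[- c]mulN1r; apply: value_at1_mul.
by have := value_at1_poly (-1); rewrite hornerN hornerE !tofracN !tofrac1.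
Qed.

Lemma value_at1_mulrz (f : At) c m : value_at1 f c -> value_at1 (f *~ m) (c *~ m).
Proof.
move=> fc; have H j : value_at1 (f *+ j) (c *+ j).
  elim: j => [|j IH]; rewrite ?mulr0n; first exact: value_at1_0.
  by rewrite !mulrS; exact: value_at1_add.
by case: m => j; [exact: H|rewrite NegzE !mulrNz; apply/value_at1_opp/H].
Qed.

Lemma value_at1_Xz m : value_at1 (exprz (tofrac 'X : At) m) 1.
Proof.
case: m => j /=.
  by have := value_at1_poly 'X^j; rewrite tofracXn hornerXn expr1n tofrac1.
exists 1, 'X^(j.+1); split.
- by rewrite hornerXn expr1n oner_eq0.
- by rewrite tofrac1 div1r tofracXn.
- have -> : (1 : {poly A}).[1] = 1 by rewrite hornerE.
  by rewrite hornerXn expr1n tofrac1 divr1.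
Qed.

Lemma value_at1_det p (M : 'M[At]_p) (N : 'M[{fraction A}]_p) :
  (forall i j, value_at1 (M i j) (N i j)) -> value_at1 (\det M) (\det N).
Proof.
move=> MN; rewrite /determinant.
elim/big_rec2: _ => [|s f c _ fc]; first exact: value_at1_0.
apply: (value_at1_add _ fc); apply: value_at1_mul.
  by case: (odd_perm s); rewrite ?expr0 ?expr1; [apply: value_at1_opp|];
     exact: value_at1_1.
elim/big_rec2: _ => [|i f' c' _ fc']; first exact: value_at1_1.
exact: (value_at1_mul (MN _ _) fc').
Qed.

Lemma laurent_value_at1 (z : At) : laurent z -> exists c, value_at1 z c.
Proof.
move=> [p [d ->]]; exists (tofrac p.[1] / tofrac 'X^d.[1]), p, 'X^d.
by rewrite hornerXn expr1n oner_eq0.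
Qed.

Definition laurent_pred : {pred At} := [pred z | `[< laurent z >]].

Lemma laurent_subring_closed : subring_closed laurent_pred.
Proof.
have Xn0 d : tofrac ('X^d : {poly A}) != 0.
  by rewrite tofrac_eq0 -size_poly_eq0 size_polyXn.
split=> [|x y /asboolP[p [d ->]] /asboolP[q [e ->]]|
          x y /asboolP[p [d ->]] /asboolP[q [e ->]]]; apply/asboolP.
- by exists 1, 0; rewrite expr0 !tofrac1 divr1.
- exists (p * 'X^e - q * 'X^d), (d + e).
  by rewrite exprD tofracB !tofracM -[- (tofrac q / _)]mulNr addf_div// mulNr.
- by exists (p * q), (d + e); rewrite exprD !tofracM mulf_div.
Qed.

HB.instance Definition _ :=
  GRing.isSubringClosed.Build At laurent_pred laurent_subring_closed.

Lemma laurent_Xz m : exprz (tofrac 'X : At) m \in laurent_pred.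
Proof.
apply/asboolP; case: m => j /=.
  by exists 'X^j, 0; rewrite expr0 tofrac1 divr1 tofracXn.
by exists 1, j.+1; rewrite tofrac1 mul1r tofracXn.
Qed.

Lemma laurent_det p (M : 'M[At]_p) :
  (forall i j, M i j \in laurent_pred) -> \det M \in laurent_pred.
Proof.
move=> ML; apply: rpred_sum => s _; rewrite rpredMsign.
by apply: rpred_prod => i _; exact: ML.
Qed.

(** The maximal minors of a square matrix are its determinant, up to sign: a
    strictly increasing self-map of a finite ordinal is a permutation.  The size q
    of the minors is kept apart from p because the two are equal only
    propositionally where the twisted Alexander invariant is defined. *)
Lemma laurent_gcd_minors_square p q (M : 'M[At]_p) D : q = p ->
  is_laurent_gcd (minors q M) D -> (forall i j, M i j \in laurent_pred) ->
  laurent_dvd (\det M) D.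
Proof.
move=> -> {q} [_ _ Dmax] ML; apply: Dmax => [|x [f [h [f_mono h_mono ->]]]].
  by have /asboolP := laurent_det ML.
have mono_inj (u : 'I_p -> 'I_p) : {homo u : i j / (i < j)%N} -> injective u.
  move=> um i j uij; apply: val_inj.
  by case: (ltngtP i j) => // /um; rewrite uij ltnn.
pose s := perm (mono_inj f f_mono); pose t := perm (mono_inj h h_mono).
exists ((-1) ^+ s * (-1) ^+ t).
  suff /asboolP : (-1) ^+ s * (-1) ^+ t \in laurent_pred by [].
  by rewrite rpredMsign rpred_sign.
have -> : mxsub f h M = row_perm s (col_perm t M).
  by apply/matrixP => i j; rewrite !mxE !permE.
rewrite row_permE col_permE !det_mulmx !det_perm odd_permV.
by rewrite [\det M * _]mulrC mulrA.
Qed.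
End Values.

(** * The twisted Alexander invariant at t = 1 *)

Lemma mulrz_mxE (M : zmodType) p q (B : 'M[M]_(p, q)) m i j :
  (B *~ m) i j = B i j *~ m.
Proof. by case: m => l; rewrite ?NegzE ?mulrNz ?mxE mulmxnE. Qed.

Section TwistedRep.
Variables (G : groupType) (A : idomainType) (rho : SL2rep G A) (alpha : G -> int).
Hypothesis alphaD : forall x y, alpha (x * y)%g = alpha x + alpha y.
Local Notation At := {fraction {poly A}}.
Local Notation Phi := (Phi rho alpha).

Lemma Phi_1 : Phi 1%g = 1%:M.
Proof.
have -> : Phi 1%g = exprz (tofrac 'X) (alpha 1%g) *:
  map_mx (@FracField.tofrac _ \o polyC) (rho 1%g) by [].
have /eqP := alphaD 1%g 1%g; rewrite mulg1 -{1}[alpha 1%g]addr0.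
by rewrite (inj_eq (addrI _)) => /eqP <-; rewrite expr0z scale1r SL2mx1 map_mx1.
Qed.

Lemma Phi_M : {morph Phi : x y / (x * y)%g >-> x *m y}.
Proof.
move=> x y; rewrite -[LHS]/(exprz (tofrac 'X) (alpha (x * y)%g) *:
  map_mx (@FracField.tofrac _ \o polyC) (rho (x * y)%g)).
rewrite alphaD expfzDr ?tofrac_eq0 ?polyX_eq0// SL2mxM map_mxM.
by rewrite -scalerA scalemxAr scalemxAl.
Qed.

Lemma value_at1_Phi x p q : value_at1 (Phi x p q) (tofrac (rho x p q)).
Proof.
rewrite !mxE -[tofrac (rho x p q)]mul1r.
apply: (value_at1_mul (value_at1_Xz _ _)).
by have := value_at1_poly (rho x p q)%:P; rewrite hornerC.
Qed.

Lemma laurent_Phi x p q : Phi x p q \in @laurent_pred A.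
Proof.
rewrite !mxE rpredM ?laurent_Xz//.
by apply/asboolP; exists (rho x p q)%:P, 0; rewrite expr0 tofrac1 divr1.
Qed.

Variables (n : nat) (g : 'I_n.+1 -> G) (r : 'I_n -> word n.+1).

Lemma value_at1_fox_mx a w p q :
  value_at1 (fox_mx Phi g a w p q) (tofrac (fox_mx rho g a w p q)).
Proof.
rewrite /fox_mx /ZF_ext !summxE raddf_sum.
elim/big_rec2: _ => [|t f c _ fc]; first exact: value_at1_0.
apply: (value_at1_add _ fc).
rewrite !mulrz_mxE raddfMz; apply: value_at1_mulrz; exact: value_at1_Phi.
Qed.

Lemma value_at1_bordered_fox i w :
  value_at1 (\det (bordered_fox Phi g r i w)) (tofrac (\det (bordered_fox rho g r i w))).
Proof.
rewrite -det_map_mx; apply: value_at1_det => a b; rewrite [X in value_at1 _ X]mxE.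
rewrite /bordered_fox; case: (split_ordP a) => a' ->; case: (split_ordP b) => b' ->.
- by rewrite !block_mxEul; exact: value_at1_fox_mx.
- by rewrite !block_mxEur !mxE; exact: value_at1_fox_mx.
- by rewrite !block_mxEdl !mxE; exact: value_at1_fox_mx.
- by rewrite !block_mxEdr !mxE; exact: value_at1_fox_mx.
Qed.

Lemma laurent_minor_fox i a b : minor_fox Phi g r i a b \in @laurent_pred A.
Proof.
rewrite mxE /fox_mx /ZF_ext summxE; apply: rpred_sum => t _.
by rewrite mulrz_mxE rpredMz// laurent_Phi.
Qed.

(** Multiply Delta = D / det(Phi(g_i) - 1) by det(Phi(w) - 1).  As D is z times the
    determinant of the minor, [det_bordered_fox] turns the product into z times the
    determinant of the bordered matrix, and in this equation the denominator
    det(Phi(g_i) - 1), which may vanish at t = 1, has disappeared. *)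
Lemma det_bordered_fox_neq0 Delta c w :
  (forall j, weval g (r j) = 1%g) -> is_twisted_alexander rho alpha g r Delta ->
  value_at1 Delta c -> c != 0 -> \det (rho (weval g w) - 1%:M) != 0 ->
  exists i, \det (bordered_fox rho g r i w) != 0.
Proof.
move=> rel [i [D [Bi_neq0 D_gcd DeltaE]]] Delta1 c_neq0 w_neq0; exists i.
have [//||z zL DE] := laurent_gcd_minors_square _ D_gcd.
- by rewrite sum_nat_const card_ord.
- exact: laurent_minor_fox.
have key : Delta * \det (Phi (weval g w) - 1%:M) = z * \det (bordered_fox Phi g r i w).
  apply: (mulfI Bi_neq0); rewrite DeltaE mulrA [X in X * _]mulrC divfK//.
  by rewrite DE [RHS]mulrCA (det_bordered_fox Phi_1 Phi_M)// -mulrA [X in z * X]mulrC.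
have [cz zc] := laurent_value_at1 zL.
have w1 : value_at1 (\det (Phi (weval g w) - 1%:M))
                    (tofrac (\det (rho (weval g w) - 1%:M))).
  rewrite -det_map_mx; apply: value_at1_det => a b; rewrite !mxE rmorphB rmorph_nat.
  apply: value_at1_add; first by have := value_at1_Phi (weval g w) a b; rewrite !mxE.
  apply: value_at1_opp; case: (a == b); first exact: value_at1_1.
  exact: value_at1_0.
have w_neq0' : tofrac (\det (rho (weval g w) - 1%:M)) != 0 by rewrite tofrac_eq0.
have := value_at1_mul Delta1 w1; rewrite key => /value_at1_uniq.
move=> /(_ _ (value_at1_mul zc (value_at1_bordered_fox i w))) eq1.
apply: contra_neq (mulf_neq0 c_neq0 w_neq0') => det0.
by rewrite eq1 det0 tofrac0 mulr0.
Qed.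
End TwistedRep.

(** * Torsion *)

Section Torsion.
Local Open Scope quotient_scope.
Variables (G : groupType) (A : idomainType) (rho : SL2rep G A).
Variables (n : nat) (g : 'I_n.+1 -> G) (r : 'I_n -> word n.+1).

(** The determinant of the bordered matrix annihilates H_1.  Cramer's rule writes
    its multiple of a cycle as the bordered matrix times some Y, and the first
    block of Y vanishes because d_1 kills the cycle and the columns of the
    relators, but acts on the column of w as rho(w) - 1. *)
Lemma twisted_H1_torsion i w :
  (forall j, weval g (r j) = 1%g) ->
  \det (bordered_fox rho g r i w) != 0 ->
  \det (rho (weval g w) - 1%:M) != 0 ->
  torsion_module (twisted_H1 rho g r).
Proof.
move=> rel det_neq0 w_neq0; elim/quotW => z.
set d := \det _ in det_neq0; exists d => //.
pose v := val z.
have zv : twisted_d1 rho g v = 0 by apply/eqP; exact: (valP z).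
pose V := col_mx (v i) (\mxcol_l v (lift i l)) : 'cV_(2 + \sum_(l < n) 2).
pose Y := \adj (bordered_fox rho g r i w) *m V.
have dV : d *: V = bordered_fox rho g r i w *m Y.
  by rewrite mulmxA mul_mx_adj mul_scalar_mx.
have BV : usubmx (boundary_mx rho g i *m V) = 0.
  rewrite mul_block_col col_mxKu mul_mxrow_mxcol.
  by move: zv; rewrite /twisted_d1 (bigD1_ord i).
have b0 : usubmx Y = 0.
  have : usubmx (boundary_mx rho g i *m (d *: V)) = 0.
    by rewrite -scalemxAr linearZ /= BV scaler0.
  rewrite dV mulmxA (boundary_bordered_fox (SL2mx1 rho) (SL2mxM rho))//.
  rewrite -{1}[Y]vsubmxK mul_block_col col_mxKu mul0mx addr0 => bw.
  apply: (scalemx_inj w_neq0).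
  by rewrite -mul_scalar_mx -mul_adj_mx -mulmxA bw mulmx0 scaler0.
pose u := [ffun j => submxcol (dsubmx Y : 'cV_(\sum_(j < n) 2)) j].
have du : twisted_d2 rho g r u = d *: v.
  have YE : Y = col_mx 0 (\mxcol_j u j).
    rewrite -[LHS]vsubmxK b0 -[dsubmx Y]submxcolK; congr col_mx.
    by apply: eq_mxcol => j; rewrite ffunE.
  move: dV; rewrite YE mul_block_col !mulmx0 !add0r scale_col_mx => /eq_col_mx[].
  rewrite mul_mxrow_mxcol mul_mxblock_mxrow => di dl.
  apply/ffunP => a; rewrite !ffunE; have [l ->|->] := unliftP i a; last by [].
  have dvl : d *: (\mxcol_l v (lift i l)) = \mxcol_(l < n) (d *: v (lift i l)).
    by apply/matrixP => s t; rewrite !mxE.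
  by move: dl; rewrite dvl => /eq_mxcolP/(_ l) ->.
pose p y : twisted_H1 rho g r := \pi_(Quotient.quot _) y.
have pZ : d *: p z = p (d *: z) by apply: qscaleE; exact: is_boundary_scaler.
rewrite -[LHS]/(d *: p z) pZ.
apply/eqP; rewrite -[0]pi_zeror -Quotient.idealrBE subr0.
apply/asboolP; exists u; rewrite [RHS]linearZ; exact: du.
Qed.
End Torsion.

(** [invmx] is the identity on singular matrices, so a singular gamma would satisfy
    gamma * gamma = rho(1) = 1, a contradiction. *)
Lemma conj_rep_unitmx (G : groupType) (A : comUnitRingType)
    (rho : SL2rep G A) (rho' : G -> 'M[A]_2) (gamma : 'M[A]_2) :
  (forall x, rho x = invmx gamma *m rho' x *m gamma) -> rho' 1%g = 1%:M ->
  gamma \in unitmx.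
Proof.
move=> conj rho'1; apply: contraT => gN.
have := conj 1%g; rewrite rho'1 mulmx1 SL2mx1 (invmx_out gN) => gg.
by case/negP: gN; case: (mulmx1_unit (esym gg)).
Qed.

Theorem theorem3p2p4
  (RR : realType) (K : set 'rV[RR]_4) (K_knot : is_knot K) (x0 : knot_exterior K)
  (n : nat) (g : 'I_n.+1 -> knot_group x0) (r : 'I_n -> word n.+1)
  (gr_presentation : is_presentation g r)
  (alpha : knot_group x0 -> int) (alpha_ab : is_abelianization alpha)
  (k : fieldType) (k_perfect : perfect_field k) (k_char : 2%N \notin [pchar k])
  (O : idomainType) (resO : {rmorphism O -> k}) (O_cdvr : complete_dvr_residue resO)
  (rhobar : SL2rep (knot_group x0) k)
  (rhobar_irr : absolutely_irreducible rhobar)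
  (Ru : idomainType) (cRu : CL_structure resO Ru)
  (rhou : SL2rep (knot_group x0) Ru)
  (rhou_univ : is_universal_deformation rhobar cRu rhou)
  (Ru_noetherian : noetherian Ru)
  (cond2 : exists (R : idomainType) (cR : CL_structure resO R)
                  (rho : SL2rep (knot_group x0) R),
     [/\ is_deformation rhobar cR rho,
         noetherian R,
         factorial_domain R,
         (exists x : knot_group x0, \det (rho x - 1%:M) != 0)
       & exists (Delta : {fraction {poly R}}) (c : {fraction R}),
           [/\ is_twisted_alexander rho alpha g r Delta,
               value_at1 Delta c
             & c != 0]]) :
  finitely_generated (twisted_H1 rhou g r) /\
  torsion_module (twisted_H1 rhou g r).
Proof.
split; first exact: twisted_H1_finitely_generated.
have [gen rel_nc] := gr_presentation.
have rel j : weval g (r j) = 1%g by apply/rel_nc; exact: Nrel.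
have [R [cR [rho [rho_def _ _ [x x_neq0] [Delta [c [Delta_def Delta1 c_neq0]]]]]]] := cond2.
have [w xE] := gen x; rewrite {}xE {x} in x_neq0.
have [alphaD _ _] := alpha_ab.
have [i i_neq0] := det_bordered_fox_neq0 alphaD rel Delta_def Delta1 c_neq0 x_neq0.
have [psi [_ [gamma [_ rhoE]] _]] := rhou_univ.2 _ _ _ rho_def.
have gU : gamma \in unitmx.
  by apply: (conj_rep_unitmx rhoE); rewrite SL2mx1 map_mx1.
apply: (@twisted_H1_torsion _ _ _ _ _ _ i w) => //.
- move: i_neq0; rewrite (det_bordered_fox_conj _ _ _ _ gU rhoE).
  rewrite -map_bordered_fox det_map_mx.
  by apply: contra_neq => ->; rewrite rmorph0.
- apply: contra_neq x_neq0 => det0.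
  have -> : rho (weval g w) - 1%:M =
      invmx gamma *m map_mx psi (rhou (weval g w) - 1%:M) *m gamma.
    by rewrite map_mxB map_mx1 mulmxBr mulmxBl mulmx1 mulVmx// rhoE.
  by rewrite !det_mulmx det_map_mx det0 rmorph0 mulr0 mul0r.
Qed.
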